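(* Let $G$ be the tree with vertices $A, C_1, C_2, C_3, A', C'_1, C'_2, C'_3$ and the seven edges $C_3C'_3$, $AC_i$, $A'C'_i$ for $i=1,2,3$. Let $H$ be the tree with vertices $B, D, P_1, P_2, P_3, Q_1, Q_2, Q_3$ and the seven edges $BD$, $BP_i$, $P_iQ_i$ for $i=1,2,3$. Then $G$ and $H$ are unfriendly, i.e. there is no realizable bijection from the set of edges of $G$ to the set of edges of $H$.
   Context: Let $Y$ be a tree and let $p, q$ be sets of edges of $Y$. The set $p$ is on the same side of $q$ (in $Y$) if $p\cap q=\emptyset$ and for any two vertices that are endpoints of edges of $p$, the path in $Y$ connecting these two vertices contains an even number of edges of $q$. The sets $p$ and $q$ are unlinked (in $Y$) if $p$ is on the same side of $q$ and $q$ is on the same side of $p$. For a vertex $P$ of a graph, $\delta P$ denotes the set of all edges having $P$ as an endpoint. Let $K, K'$ be trees with the same number of edges and let $h$ be a bijection from the edges of $K$ to the edges of $K'$. Then $h$ is realizable if for any two distinct vertices $A, B$ of $K$ such that the path in $K$ joining $A$ and $B$ contains an even number of edges, the edge sets $h(\delta A)$ and $h(\delta B)$ are unlinked in $K'$. The trees $K$ and $K'$ are friendly if such a realizable bijection exists, and unfriendly otherwise. *)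

(* Defs.v *)
From HB Require Import structures.
From mathcomp Require Import all_boot.

Set Implicit Arguments.
Unset Strict Implicit.
Unset Printing Implicit Defensive.

Definition connected (V : finType) (e : rel V) : Prop :=
  forall x y : V, connect e x y.

(* For a symmetric irreflexive relation the repetition-free closed walks of
   size at most 2 are the empty one and the traversals of an edge back and
   forth, so the cycles of the graph are those of size at least 3. *)
Definition acyclic (V : finType) (e : rel V) : Prop :=
  forall c : seq V, ucycle e c -> size c <= 2.

Record tree := Tree {
  vertex :> finType;
  adj : rel vertex;
  tree_nonempty : 0 < #|vertex|;
  adj_sym : symmetric adj;
  adj_irr : irreflexive adj;
  tree_connected : connected adj;
  tree_acyclic : acyclic adj
}.

Definition edges (Y : tree) : {set {set Y}} :=
  [set [set x; y] | x in Y, y in Y & adj x y].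

Definition edge (Y : tree) : finType := {f : {set Y} | f \in edges Y}.

(* The list s of vertices following x on a simple path from x to y. *)
Definition simple_path (Y : tree) (x y : Y) : pred (seq Y) :=
  fun s => [&& path (@adj Y) x s, last x s == y & uniq (x :: s)].

Lemma simple_path_exists (Y : tree) (x y : Y) : exists s, simple_path x y s.
Proof.
have /connectP[p pP ->] := tree_connected x y.
case/shortenP: pP => s sP sU _.
by exists s; rewrite /simple_path sP eqxx.
Qed.

Lemma simple_path_uniq (Y : tree) (x y : Y) (s t : seq Y) :
  simple_path x y s -> simple_path x y t -> s = t.
Proof.
elim: s x t => [|a s IHs] x [|b t] //.
- case/and3P=> _ /eqP exy _ /and3P[_ /eqP ly /andP[xt _]].
  by move: xt; rewrite [x in x \notin _]exy -ly /= mem_last.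
- case/and3P=> _ /eqP ls /andP[xs _] /and3P[_ /eqP exy _].
  by move: xs; rewrite [x in x \notin _]exy -ls /= mem_last.
case/and3P=> /andP[xa ps] /eqP ls /andP[xs us].
case/and3P=> /andP[xb pt] /eqP lt /andP[xt ut].
have [eab|nab] := eqVneq a b.
  rewrite -eab in pt lt ut *; congr (_ :: _); apply: (IHs a).
    by apply/and3P; split=> //; apply/eqP.
  by apply/and3P; split=> //; apply/eqP.
pose e := [rel u v : Y | [&& adj u v, u != x & v != x]].
have esym : connect_sym e.
  by apply: sym_connect_sym => u v; rewrite /= adj_sym [(u != x) && _]andbC.
have lift_path c p : path (@adj Y) c p -> x \notin c :: p -> path e c p.
  elim: p c => //= d p IHp c /andP[cd pp] xN.
  have [xc xdp] : x != c /\ x \notin d :: p.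
    by apply/andP; rewrite -negb_or -in_cons.
  rewrite cd IHp // eq_sym xc /= andbT.
  by move: xdp; rewrite in_cons negb_or eq_sym => /andP[].
have cas : connect e a y by apply/connectP; exists s => //; apply: lift_path.
have cbt : connect e b y by apply/connectP; exists t => //; apply: lift_path.
have /connectP[p0 p0P pb] : connect e a b.
  by apply: connect_trans cas _; rewrite esym.
case/shortenP: p0P pb => p pP pU _ pb.
have xN : x \notin a :: p.
  have xa' : x != a by apply: contraNneq xs => ->; rewrite mem_head.
  rewrite in_cons negb_or xa' /=.
  elim: p a pP {cas xa ps ls xs us nab pU pb xa'} => //= d p IHp c.
  by case/andP=> /and3P[_ _ dx] /IHp xp; rewrite in_cons negb_or eq_sym dx.
have pA : path (@adj Y) a p by apply: sub_path pP => u v /and3P[].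
have /tree_acyclic : ucycle (@adj Y) (x :: a :: p).
  rewrite /ucycle; apply/andP; split; last by rewrite cons_uniq xN.
  by rewrite /= xa rcons_path pA -pb adj_sym.
by case: p pb {pP pU xN pA} => // eab; rewrite eab eqxx in nab.
Qed.

(* The path in Y from x to y, unique by simple_path_uniq. *)
Definition path_of (Y : tree) (x y : Y) : seq Y :=
  xchoose (simple_path_exists x y).

Definition path_edges (Y : tree) (x y : Y) : {set edge Y} :=
  [set f : edge Y |
    val f \in pairmap (fun u v : Y => [set u; v]) x (path_of x y)].

Definition same_side (Y : tree) (p q : {set edge Y}) : Prop :=
  p :&: q = set0 /\
  forall (f g : edge Y) (u v : Y),
    f \in p -> g \in p -> u \in val f -> v \in val g ->
    ~~ odd #|path_edges u v :&: q|.

Definition unlinked (Y : tree) (p q : {set edge Y}) : Prop :=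
  same_side p q /\ same_side q p.

Definition delta (Y : tree) (P : Y) : {set edge Y} :=
  [set f : edge Y | P \in val f].

Definition realizable (K K' : tree) (h : edge K -> edge K') : Prop :=
  forall A B : K, A != B -> ~~ odd #|path_edges A B| ->
    unlinked (h @: delta A) (h @: delta B).

Definition friendly (K K' : tree) : Prop :=
  exists h : edge K -> edge K', bijective h /\ realizable h.

Definition unfriendly (K K' : tree) : Prop := ~ friendly K K'.

Definition adj_of (T : eqType) (E : seq (T * T)) : rel T :=
  fun x y => ((x, y) \in E) || ((y, x) \in E).

(* Acyclicity from a rooting: d is the distance to the root, and a vertex has
   at most one neighbour that is not farther from the root than itself. *)
Lemma acyclic_rooted (V : finType) (e : rel V) (d : V -> nat) :
    symmetric e ->
    (forall x y z, e x y -> e x z -> d y <= d x -> d z <= d x -> y = z) ->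
  acyclic e.
Proof.
move=> esym dP c cc; rewrite leqNgt; apply/negP => c3.
have [x0 x0c] : exists x, x \in c.
  by case: c c3 {cc} => // x c _; exists x; rewrite mem_head.
have [x xc xmax] := arg_maxnP d (x0c : [pred x | x \in c] x0).
case: (rot_to xc) => i c' ec'.
have : ucycle e (x :: c') by rewrite -ec' rot_ucycle.
have : size (x :: c') > 2 by rewrite -ec' size_rot.
have {xmax}dmax z : z \in c' -> d z <= d x.
  by move=> zc; apply: xmax; rewrite inE -(mem_rot i) ec' in_cons zc orbT.
case: c' dmax {ec'} => [|y c'] // dmax; case/lastP: c' dmax => // c' z dmax _.
case/andP=> /= /andP[xy]; rewrite rcons_path last_rcons => /andP[_ zx].
have yz : y = z.
  apply: (dP x) => //; first by rewrite esym.
    by apply: dmax; rewrite mem_head.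
  by apply: dmax; rewrite in_cons mem_rcons mem_head orbT.
by rewrite yz mem_rcons mem_head andbF.
Qed.

Inductive Gvert : predArgType :=
  GA | GC1 | GC2 | GC3 | GA' | GC1' | GC2' | GC3'.

Definition Gverts : seq Gvert := [:: GA; GC1; GC2; GC3; GA'; GC1'; GC2'; GC3'].

Definition Gcode (x : Gvert) : nat :=
  match x with
  | GA => 0 | GC1 => 1 | GC2 => 2 | GC3 => 3
  | GA' => 4 | GC1' => 5 | GC2' => 6 | GC3' => 7
  end.

Lemma GcodeK : cancel Gcode (nth GA Gverts). Proof. by case. Qed.

HB.instance Definition _ := Countable.copy Gvert (can_type GcodeK).

Lemma Gverts_axiom : Finite.axiom Gverts. Proof. by case. Qed.

HB.instance Definition _ := isFinite.Build Gvert Gverts_axiom.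

Definition Gadj : rel Gvert :=
  adj_of [:: (GC3, GC3');
             (GA, GC1); (GA, GC2); (GA, GC3);
             (GA', GC1'); (GA', GC2'); (GA', GC3')].

Lemma Gnonempty : 0 < #|Gvert|. Proof. by apply/card_gt0P; exists GA. Qed.

Lemma Gsym : symmetric Gadj. Proof. by case; case. Qed.

Lemma Girr : irreflexive Gadj. Proof. by case. Qed.

Lemma Gconnected : connected Gadj.
Proof.
suff cA x : connect Gadj GA x.
  by move=> x y; apply: connect_trans (cA y); rewrite (sym_connect_sym Gsym).
apply/connectP; exists (match x with
  | GA => [::] | GC1 => [:: GC1] | GC2 => [:: GC2] | GC3 => [:: GC3]
  | GC3' => [:: GC3; GC3'] | GA' => [:: GC3; GC3'; GA']
  | GC1' => [:: GC3; GC3'; GA'; GC1'] | GC2' => [:: GC3; GC3'; GA'; GC2']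
  end); by case: x.
Qed.

Lemma Gacyclic : acyclic Gadj.
Proof.
apply: (@acyclic_rooted _ _ (fun x => match x with
  | GA => 0 | GC1 | GC2 | GC3 => 1 | GC3' => 2 | GA' => 3 | GC1' | GC2' => 4
  end) Gsym).
by case; case=> //; case.
Qed.

Definition G : tree := Tree Gnonempty Gsym Girr Gconnected Gacyclic.

Inductive Hvert : predArgType :=
  HB | HD | HP1 | HP2 | HP3 | HQ1 | HQ2 | HQ3.

Definition Hverts : seq Hvert := [:: HB; HD; HP1; HP2; HP3; HQ1; HQ2; HQ3].

Definition Hcode (x : Hvert) : nat :=
  match x with
  | HB => 0 | HD => 1 | HP1 => 2 | HP2 => 3
  | HP3 => 4 | HQ1 => 5 | HQ2 => 6 | HQ3 => 7
  end.

Lemma HcodeK : cancel Hcode (nth HB Hverts). Proof. by case. Qed.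

HB.instance Definition _ := Countable.copy Hvert (can_type HcodeK).

Lemma Hverts_axiom : Finite.axiom Hverts. Proof. by case. Qed.

HB.instance Definition _ := isFinite.Build Hvert Hverts_axiom.

Definition Hadj : rel Hvert :=
  adj_of [:: (HB, HD);
             (HB, HP1); (HB, HP2); (HB, HP3);
             (HP1, HQ1); (HP2, HQ2); (HP3, HQ3)].

Lemma Hnonempty : 0 < #|Hvert|. Proof. by apply/card_gt0P; exists HB. Qed.

Lemma Hsym : symmetric Hadj. Proof. by case; case. Qed.

Lemma Hirr : irreflexive Hadj. Proof. by case. Qed.

Lemma Hconnected : connected Hadj.
Proof.
suff cB x : connect Hadj HB x.
  by move=> x y; apply: connect_trans (cB y); rewrite (sym_connect_sym Hsym).
apply/connectP; exists (match x with
  | HB => [::] | HD => [:: HD] | HP1 => [:: HP1] | HP2 => [:: HP2]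
  | HP3 => [:: HP3] | HQ1 => [:: HP1; HQ1] | HQ2 => [:: HP2; HQ2]
  | HQ3 => [:: HP3; HQ3]
  end); by case: x.
Qed.

Lemma Hacyclic : acyclic Hadj.
Proof.
apply: (@acyclic_rooted _ _ (fun x => match x with
  | HB => 0 | HD | HP1 | HP2 | HP3 => 1 | HQ1 | HQ2 | HQ3 => 2
  end) Hsym).
by case; case=> //; case.
Qed.

Definition H : tree := Tree Hnonempty Hsym Hirr Hconnected Hacyclic.

(* Main.v *)
Require Import Defs.
From mathcomp Require Import all_boot.

Set Implicit Arguments.
Unset Strict Implicit.
Unset Printing Implicit Defensive.

(** In a rooted tree every edge is named by its lower endpoint, and the number
    of edges of q on the path from u to v has the parity of the sum of those on
    the paths from u and from v to the root.  Hence "same side" becomes a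
    condition on lists of vertices that is decided by evaluation.  A bijection
    from the edges of G to those of H is a list of the seven non-root vertices
    of H, and none of the 5040 such lists satisfies the condition for all pairs
    of distinct vertices of G at even distance. *)

Record rooting (Y : tree) := Rooting {
  root : Y;
  parent : Y -> Y;
  depth : Y -> nat;
  adj_parent : forall u v : Y, adj u v =
    (u != root) && (v == parent u) || (v != root) && (u == parent v);
  depth_parent : forall v, v != root -> depth v = (depth (parent v)).+1
}.

Definition upper_edge (Y : tree) (R : rooting Y) (v : Y) (f : edge Y) : bool :=
  (v != root R) && (val f == [set v; parent R v]).

Lemma upper_edge_uniq (Y : tree) (R : rooting Y) (v : Y) (f g : edge Y) :
  upper_edge R v f -> upper_edge R v g -> f = g.
Proof.
by move=> /andP[_ /eqP fv] /andP[_ /eqP gv]; apply: val_inj; rewrite fv gv.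
Qed.

(** Two different lower endpoints of [f] would be parents of each other, so the depth of [u] would
    exceed itself by 2. *)
Lemma upper_edge_inj (Y : tree) (R : rooting Y) (f : edge Y) (u v : Y) :
  upper_edge R u f -> upper_edge R v f -> u = v.
Proof.
move=> /andP[ur /eqP fu] /andP[vr /eqP fv].
have : u \in val f by rewrite fu set21.
have : v \in val f by rewrite fv set21.
rewrite {1}fu fv => /set2P[-> //|vu] /set2P[// |uv].
have /eqP := depth_parent ur; rewrite -vu (depth_parent vr) -uv.
by rewrite -addn2 -[X in X == _]addn0 eqn_add2l.
Qed.

Lemma upper_edge_exists (Y : tree) (R : rooting Y) (v : Y) :
  v != root R -> exists f, upper_edge R v f.
Proof.
move=> vr.
have fE : [set v; parent R v] \in edges Y.
  apply/imset2P; exists v (parent R v) => //.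
  by rewrite !inE /= (adj_parent R) vr eqxx.
by exists (exist (fun e => e \in edges Y) _ fE); rewrite /upper_edge vr /=.
Qed.

Lemma upper_edge_or (Y : tree) (R : rooting Y) (f : edge Y) (u v : Y) :
  adj u v -> val f = [set u; v] ->
  upper_edge R u f /\ v = parent R u \/ upper_edge R v f /\ u = parent R v.
Proof.
rewrite (adj_parent R) /upper_edge => /orP[] /andP[-> /eqP ->] ->.
  by left; rewrite eqxx.
by right; rewrite setUC eqxx.
Qed.

Lemma upper_vertex_exists (Y : tree) (R : rooting Y) (f : edge Y) :
  exists v, upper_edge R v f.
Proof.
have /imset2P[u v _] := valP f; rewrite inE => /andP[_ uv] fuv.
by case: (upper_edge_or R uv fuv) => -[]; [exists u | exists v].
Qed.

(** If the root has depth 0, [traject] lists the lower endpoints of the edges from [v] to the root.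
    Any other depth there shifts all values by one constant, which cancels in sums. *)
Definition root_parity (Y : tree) (R : rooting Y) (c : pred Y) (v : Y) : bool :=
  odd (count c (traject (parent R) v (depth R v))).

Lemma root_parity_parent (Y : tree) (R : rooting Y) (c : pred Y) (v : Y) :
  v != root R -> root_parity R c v = c v (+) root_parity R c (parent R v).
Proof. by move=> vr; rewrite /root_parity (depth_parent vr) /= oddD oddb. Qed.

Lemma mem_pairmap_set2 (T : finType) (x : T) (w : T) (p : seq T) (A : {set T}) :
  A \in pairmap (fun u v => [set u; v]) w p -> x \in A -> x \in w :: p.
Proof.
elim: p w => //= v p IHp w; rewrite in_cons => /orP[/eqP ->|/IHp xp /xp].
  by case/set2P=> ->; rewrite !in_cons eqxx ?orbT.
by rewrite [x \in w :: _]in_cons => ->; rewrite orbT.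
Qed.

(** Here [s] is a potential mod 2 that changes exactly across the edges of [q], so the sum along a
    path telescopes. *)
Lemma path_edges_parity (Y : tree) (q : {set edge Y}) (s : Y -> bool) :
    (forall (f : edge Y) (u v : Y),
       adj u v -> val f = [set u; v] -> (f \in q) = s u (+) s v) ->
  forall u v, odd #|path_edges u v :&: q| = s u (+) s v.
Proof.
move=> sP u v; rewrite /path_edges.
have := xchooseP (simple_path_exists u v); rewrite -/(path_of u v).
move: (path_of u v) => p; elim: p u => [|w p IHp] u.
  case/and3P=> _ /eqP <- _; rewrite addbb.
  by rewrite eq_card0 // => f; rewrite !inE.
case/and3P=> /= /andP[uw wp] lp /andP[up pU].
have fE : [set u; w] \in edges Y.
  by apply/imset2P; exists u w; rewrite // !inE.
pose f : edge Y := exist (fun e => e \in edges Y) _ fE.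
have fuw : val f = [set u; w] by [].
(* The first edge does not recur, since [u] does not; its contribution can thus be split off the
   cardinal. *)
have fN : val f \notin pairmap (fun u v : Y => [set u; v]) w p.
  by apply: contra up => /mem_pairmap_set2; apply; rewrite fuw set21.
have <- : (f \in q) (+) (s w (+) s v) = s u (+) s v.
  by rewrite (sP f _ _ uw fuw) -addbA addKb.
rewrite -IHp; last by apply/and3P.
rewrite -fuw [in LHS](cardsD1 f) oddD oddb !inE eqxx; congr (_ (+) odd _).
apply: eq_card => g; rewrite !inE (inj_eq val_inj).
by have [->|//] := eqVneq g f; rewrite (negbTE fN).
Qed.

Lemma root_parity_path (Y : tree) (R : rooting Y) (q : {set edge Y})
    (c : pred Y) :
    (forall f v, upper_edge R v f -> (f \in q) = c v) ->
  forall u v,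
    odd #|path_edges u v :&: q| = root_parity R c u (+) root_parity R c v.
Proof.
move=> cP; apply: path_edges_parity => f u v uv fuv.
case: (upper_edge_or R uv fuv) => -[vf ->]; have /andP[vr _] := vf.
  by rewrite (cP _ _ vf) (root_parity_parent _ vr) addbK.
by rewrite (cP _ _ vf) (root_parity_parent _ vr) addbC addbK.
Qed.

Definition Gparent (v : Gvert) : Gvert :=
  match v with
  | GC3' => GC3 | GA' => GC3' | GC1' | GC2' => GA' | _ => GA
  end.

Definition Gdepth (v : Gvert) : nat :=
  match v with
  | GA => 0 | GC1 | GC2 | GC3 => 1 | GC3' => 2 | GA' => 3 | GC1' | GC2' => 4
  end.

Lemma Gadj_parent (u v : G) : adj u v =
  (u != GA) && (v == Gparent u) || (v != GA) && (u == Gparent v).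
Proof. by case: u; case: v. Qed.

Lemma Gdepth_parent (v : G) : v != GA -> Gdepth v = (Gdepth (Gparent v)).+1.
Proof. by case: v. Qed.

Definition Grooting : rooting G := Rooting Gadj_parent Gdepth_parent.

Definition Hparent (v : Hvert) : Hvert :=
  match v with HQ1 => HP1 | HQ2 => HP2 | HQ3 => HP3 | _ => HB end.

Definition Hdepth (v : Hvert) : nat :=
  match v with HB => 0 | HQ1 | HQ2 | HQ3 => 2 | _ => 1 end.

Lemma Hadj_parent (u v : H) : adj u v =
  (u != HB) && (v == Hparent u) || (v != HB) && (u == Hparent v).
Proof. by case: u; case: v. Qed.

Lemma Hdepth_parent (v : H) : v != HB -> Hdepth v = (Hdepth (Hparent v)).+1.
Proof. by case: v. Qed.

Definition Hrooting : rooting H := Rooting Hadj_parent Hdepth_parent.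

(* Lists of non-root vertices stand for sets of edges. *)
Definition same_sideb (p q : seq H) : bool :=
  all2rel (fun u v => root_parity Hrooting (mem q) u ==
                      root_parity Hrooting (mem q) v)
    (p ++ map Hparent p).

(* s lists the lower endpoints of the images under h of the edges of G, and
   the result those of the edges in h (delta A). *)
Definition image_star (s : seq H) (A : G) : seq H :=
  mask [seq A \in [:: t; Gparent t] | t <- behead Gverts] s.

(** Equal parity of depths expresses even distance. *)
Definition realizableb (s : seq H) : bool :=
  all2rel (fun A B => (A != B) && (odd (Gdepth A) == odd (Gdepth B)) ==>
                      same_sideb (image_star s A) (image_star s B))
    Gverts.

Lemma permutations_not_realizable :
  all (fun s => ~~ realizableb s) (permutations (behead Hverts)).
Proof. by vm_compute. Qed.

Theorem theorem1 : unfriendly G H.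
Proof.
case=> h [/bij_inj h_inj hR].
have GsP (t : G) : (t \in behead Gverts) = (t != GA) by case: t.
(* [k] is [h] read on lower endpoints; at the root, which names no edge, it takes the dummy value
   [HB]. *)
have /fin_all_exists[k kP] (t : G) : exists v : H, t != GA ->
    exists2 f, upper_edge Grooting t f & upper_edge Hrooting v (h f).
  have [_|tr] := eqVneq t GA; first by exists HB.
  have [f ft] := upper_edge_exists (R := Grooting) tr.
  by have [v fv] := upper_vertex_exists Hrooting (h f); exists v; exists f.
pose s := map k (behead Gverts).
have s_perm : s \in permutations (behead Hverts).
  rewrite mem_permutations.
  have sU : uniq s.
    rewrite map_inj_in_uniq // => t u; rewrite !GsP => /kP[f ft fk] /kP[g gu gk].
    move=> etu; rewrite -etu in gk; move: gu.
    by rewrite -(h_inj _ _ (upper_edge_uniq fk gk)); apply: upper_edge_inj.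
  have sS : {subset s <= behead Hverts}.
    move=> _ /mapP[t tG ->]; move: tG; rewrite GsP => /kP[f _ /andP[+ _]].
    by case: (k t).
  (* Seven distinct entries among seven vertices exhaust them. *)
  by apply: uniq_perm => //; apply: (uniq_min_size sU sS _).2.
have starE A : image_star s A =
    map k [seq t <- behead Gverts | A \in [:: t; Gparent t]].
  by rewrite filter_mask map_mask.
have memG (A t : G) f : upper_edge Grooting t f ->
    (A \in val f) = (A \in [:: t; Gparent t]).
  by case/andP=> _ /eqP ->; rewrite !inE.
have starP A f v : upper_edge Hrooting v f ->
    (f \in h @: delta A) = (v \in image_star s A).
  move=> fv; rewrite starE; apply/imsetP/mapP => [[g] | [t]].
    rewrite inE => Ag fg; have [t gt] := upper_vertex_exists Grooting g.
    have tr : t != GA by case/andP: gt.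
    exists t; first by rewrite mem_filter GsP tr -(memG _ _ _ gt) Ag.
    have [g' g't g'k] := kP _ tr; rewrite -(upper_edge_uniq gt g't) -fg in g'k.
    exact: upper_edge_inj fv g'k.
  rewrite mem_filter GsP => /andP[At /kP[g gt gk]] vk.
  exists g; first by rewrite inE (memG _ _ _ gt).
  by rewrite -vk in gk; apply: upper_edge_uniq fv gk.
have starV A u : u \in image_star s A ++ map Hparent (image_star s A) ->
    exists2 f, f \in h @: delta A & u \in val f.
  have star_edge v : v \in image_star s A -> exists2 f,
      f \in h @: delta A & upper_edge Hrooting v f.
    move=> vA; have: v != HB.
      move: (vA); rewrite starE => /mapP[t]; rewrite mem_filter GsP.
      by case/andP=> _ /kP[f _ /andP[+ _]] ->.
    move/(upper_edge_exists (R := Hrooting)) => [f fv].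
    by exists f; rewrite ?(starP _ _ _ fv).
  rewrite mem_cat => /orP[/star_edge[f fA /andP[_ /eqP fu]] | /mapP[v]].
    by exists f; rewrite // fu set21.
  by move=> /star_edge[f fA /andP[_ /eqP fv]] ->; exists f; rewrite // fv set22.
have /negP[] := allP permutations_not_realizable s s_perm.
apply/(@allrelP G G) => A B _ _; apply/implyP => /andP[AB dAB].
have [|[_ ABside] _] := hR A B AB.
  (* With [q] the set of all edges, the root parity is the parity of the depth, so [A] and [B] are
     at even distance. *)
  rewrite -[path_edges _ _]setIT.
  rewrite (@root_parity_path _ Grooting _ predT) => [|f v _]; last by rewrite inE.
  by rewrite /root_parity !count_predT !size_traject (eqP dAB) addbb.
apply/allrelP => u v /starV[f fA uf] /starV[g gA vg].
have := ABside f g u v fA gA uf vg.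
by rewrite (root_parity_path (starP B)) -negb_add.
Qed.
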